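(* For all $n\geq 2$, the number of desarrangements of length $n$ avoiding both $231$ and $321$ is $d_n(231,321)=2^{n-2}$.
   Context: Permutations are in one-line notation. An index $i\in[n-1]$ is a descent of $\pi\in\mathfrak{S}_n$ if $\pi_i>\pi_{i+1}$; $i\in[n]$ is an ascent if it is not a descent (so $n$ is always an ascent). A desarrangement is a permutation whose first ascent is even. $d_n(\Pi)$ is the number of desarrangements in $\mathfrak{S}_n$ avoiding every pattern in $\Pi$ ($\pi$ avoids $\sigma$ if no subsequence of $\pi$ has the same relative order as $\sigma$). *)

(* Defs.v *)
From mathcomp Require Import all_boot all_fingroup.

Set Implicit Arguments.
Unset Strict Implicit.
Unset Printing Implicit Defensive.

(* 'S_n permutes {0, ..., n-1}; one-line notation is shifted to {1, ..., n}. *)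
Definition one_line n (pi : 'S_n) : seq nat :=
  [seq (val (pi i)).+1 | i <- enum 'I_n].

(* The i-th letter, with i counted from 1. *)
Definition letter n (pi : 'S_n) (i : nat) : nat := nth 0 (one_line pi) i.-1.

Definition is_descent n (pi : 'S_n) (i : nat) : bool :=
  (1 <= i <= n.-1) && (letter pi i.+1 < letter pi i).

Definition is_ascent n (pi : 'S_n) (i : nat) : bool :=
  (1 <= i <= n) && ~~ is_descent pi i.

(* The default 0 is reached only for n = 0, as n is an ascent when n > 0. *)
Definition first_ascent n (pi : 'S_n) : nat :=
  head 0 [seq i <- iota 1 n | is_ascent pi i].

Definition desarrangement n (pi : 'S_n) : bool := ~~ odd (first_ascent pi).

Definition same_relative_order (s t : seq nat) : bool :=
  (size s == size t) &&
  [forall i : 'I_(size s), forall j : 'I_(size s),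
     (nth 0 s i < nth 0 s j) == (nth 0 t i < nth 0 t j)].

(* The subsequences of pi are the masks of its one-line notation; patterns are
   given in one-line notation. *)
Definition avoids n (pi : 'S_n) (sigma : seq nat) : bool :=
  ~~ [exists m : n.-tuple bool,
        same_relative_order (mask m (one_line pi)) sigma].

Lemma avoidsP n (pi : 'S_n) (sigma : seq nat) :
  reflect (forall s, subseq s (one_line pi) -> ~~ same_relative_order s sigma)
          (avoids pi sigma).
Proof.
apply: (iffP existsPn) => [av s /subseqP[m szm ->] | av m].
  have szm' : size m == n by rewrite szm size_map size_enum_ord.
  exact: (av (Tuple szm')).
exact/av/mask_subseq.
Qed.

Definition num_desarr (n : nat) (Pi : seq (seq nat)) : nat :=
  #|[set pi : 'S_n | desarrangement pi & all (avoids pi) Pi]|.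

(* Main.v *)
Require Import Defs.
From mathcomp Require Import all_boot all_fingroup.
From mathcomp Require Import zify.

(** Avoiding 231 and 321 means that every letter has at most one larger letter
    before it, so the letter 1 stands in first or second position; deleting it
    is then a two-to-one map onto the avoiders of length one less, and there
    are 2^(n-1) avoiders.  An avoider has no double descent at the start, so it
    is a desarrangement iff its first two letters form a descent, i.e. iff 1
    stands second; deleting 1 is a bijection from these onto the avoiders of
    length n-1. *)

(** On words with distinct letters this is joint avoidance of 231 and 321, which differ only in the
    order of [a] and [b], left free here. *)
Definition no_min_last_triple (s : seq nat) : Prop :=
  forall a b c, subseq [:: a; b; c] s -> (a <= c) || (b <= c).

Definition insert_first (s : seq nat) : seq nat := 1 :: map S s.

(** The value on the empty word keeps the map injective and its result a rearrangement of
    [insert_first s]. *)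
Definition insert_second (s : seq nat) : seq nat :=
  if map S s is x :: t then [:: x, 1 & t] else [:: 1].

(* Indexed so that [avoiders n] lists the avoiders of length n + 1: on the empty
   word the two insertions coincide. *)
Fixpoint avoiders (n : nat) : seq (seq nat) :=
  if n is m.+1 then
    map insert_first (avoiders m) ++ map insert_second (avoiders m)
  else [:: [:: 1]].

Lemma no_min_last_triple_sub s t :
  subseq s t -> no_min_last_triple t -> no_min_last_triple s.
Proof. by move=> st Ht a b c /subseq_trans/(_ st)/Ht. Qed.

Lemma no_min_last_triple_mapS s :
  no_min_last_triple (map S s) <-> no_min_last_triple s.
Proof.
split=> H a b c.
  by move/(map_subseq S)/H.
move=> sub; have := H a.-1 b.-1 c.-1.
have := map_subseq predn sub; rewrite (mapK succnK) => sub' /(_ sub').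
(* As [predn] truncates at 0, [a.-1 <= c.-1] gives [a <= c] only once [c] is known to be
   positive. *)
have /mapP[c' _ ->] : c \in map S s.
  by apply: (mem_subseq sub); rewrite !inE eqxx !orbT.
lia.
Qed.

Lemma no_min_last_triple_insert_first s :
  no_min_last_triple s -> no_min_last_triple (insert_first s).
Proof.
move=> /no_min_last_triple_mapS H a b c; rewrite /insert_first /=.
case: eqP => [-> sub|_ /H //].
have /mapP[c' _ ->] : c \in map S s.
  by apply: (mem_subseq sub); rewrite !inE eqxx !orbT.
by [].
Qed.

(** A triple starting with the first letter either has 1 in the middle, which is at most the last
    letter, or misses this 1 and lies in the shifted word. Any other triple lies in the tail, where
    1 comes first. *)
Lemma no_min_last_triple_insert_second s :
  no_min_last_triple s -> no_min_last_triple (insert_second s).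
Proof.
case: s => [|x s] H; first by move=> a b c /size_subseq.
move/no_min_last_triple_mapS: (H); rewrite /insert_second /= => HS a b c.
have pos t : subseq [:: t] (map S s) -> 1 <= t.
  by rewrite sub1seq => /mapP[t' _ ->].
have H1 : no_min_last_triple (1 :: map S s).
  by apply: (@no_min_last_triple_insert_first s); apply: no_min_last_triple_sub H; exact: subseq_cons.
rewrite [subseq _ _]/=; case: (a =P x.+1) => [->|_]; last exact: H1.
case: (b =P 1) => [-> /pos -> |_ sub]; first by rewrite orbT.
by apply: HS => /=; rewrite eqxx.
Qed.

Lemma perm_insert_first n s :
  perm_eq (insert_first s) (iota 1 n.+1) = perm_eq s (iota 1 n).
Proof.
rewrite /insert_first /= perm_cons (iotaDl 1 1 n).
by apply/idP/idP => [/(perm_map_inj succn_inj)|/(perm_map S)].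
Qed.

Lemma perm_insert_second s : perm_eq (insert_second s) (insert_first s).
Proof.
case: s => [|x s] //=; rewrite /insert_second /insert_first /=.
by rewrite -[[:: x.+1, 1 & _]]/([:: x.+1] ++ [:: 1] ++ _) perm_catCA.
Qed.

Lemma mapS_predK (t : seq nat) : 0 \notin t -> map S (map predn t) = t.
Proof.
by move=> t0; rewrite -map_comp map_id_in // => -[|x] //= /(negP t0).
Qed.

Lemma avoider_insert_first_or_second n s :
  perm_eq s (iota 1 n.+1) -> no_min_last_triple s ->
  exists2 t, perm_eq t (iota 1 n) /\ no_min_last_triple t
           & s = insert_first t \/ s = insert_second t.
Proof.
move=> ps H.
have s0 : 0 \notin s by rewrite (perm_mem ps) mem_iota.
have s1 : 1 \in s by rewrite (perm_mem ps) mem_iota.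
case: s ps H s0 s1 => [|x s] // ps H; rewrite inE negb_or => /andP[x0 s0].
case: (x =P 1) => [Ex _|xn1].
  subst x; have Es := mapS_predK _ s0; exists (map predn s); last by left; rewrite /insert_first Es.
  split; last first.
    by apply/no_min_last_triple_mapS; rewrite Es; apply: no_min_last_triple_sub H; exact: subseq_cons.
  by rewrite -perm_insert_first /insert_first Es.
rewrite inE => /predU1P[/esym //|s1].
case: s s0 s1 ps H => [|y s] //; rewrite inE negb_or => /andP[y0 s0] s1 ps H.
(* Further right, 1 would end the triple [x], [y], 1 below two larger letters. *)
have Ey : y = 1.
  move: s1; rewrite inE => /predU1P[//|s1].
  have := H x y 1; rewrite /= !eqxx sub1seq => /(_ s1); lia.
subst y; pose t := map predn (x :: s).
have Et : map S t = x :: s by rewrite mapS_predK // inE negb_or x0.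
have Es : [:: x, 1 & s] = insert_second t by rewrite /insert_second Et.
exists t; last by right.
split; last first.
  apply/no_min_last_triple_mapS; rewrite Et; apply: no_min_last_triple_sub H.
  by rewrite /= eqxx; exact: (subseq_cons s 1).
by rewrite -perm_insert_first -(permPl (perm_insert_second t)) -Es.
Qed.

Lemma avoidersP n s :
  s \in avoiders n <-> perm_eq s (iota 1 n.+1) /\ no_min_last_triple s.
Proof.
elim: n s => [|n IH] s.
  rewrite inE; split=> [/eqP ->|[ps _]]; first by split=> // a b c /size_subseq.
  by rewrite (perm_small_eq _ ps).
rewrite mem_cat; split=> [|[ps H]].
  case/orP=> /mapP[t /IH[pt H] ->].
    by split; [rewrite perm_insert_first | exact: no_min_last_triple_insert_first].
  split; last exact: no_min_last_triple_insert_second.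
  by rewrite (permPl (perm_insert_second t)) perm_insert_first.
by have [t /IH Lt [->|->]] := avoider_insert_first_or_second _ _ ps H;
  rewrite (map_f _ Lt) ?orbT.
Qed.

Lemma insert_second_inj : injective insert_second.
Proof.
by move=> [|x s] [|y t] //= [-> /(inj_map succn_inj) ->].
Qed.

Lemma insert_first_inj : injective insert_first.
Proof. by move=> s t [/(inj_map succn_inj)]. Qed.

Lemma size_avoiders n : size (avoiders n) = 2 ^ n.
Proof. by elim: n => //= n IH; rewrite size_cat !size_map IH addnn expnS mul2n. Qed.

(** A positive first letter becomes at least 2 under [insert_second] and stands before the 1. This
    separates the images of the two insertions and yields the descent at the start. *)
Lemma avoiders_cons n s :
  s \in avoiders n -> exists x t, s = x.+1 :: t.
Proof.
move=> /avoidersP[ps _]; have s0 : 0 \notin s by rewrite (perm_mem ps) mem_iota.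
by case: s ps s0 => [/perm_size|[|x] s] //; exists x, s.
Qed.

Lemma uniq_avoiders n : uniq (avoiders n).
Proof.
elim: n => //= n IH.
rewrite cat_uniq (map_inj_uniq insert_first_inj) (map_inj_uniq insert_second_inj) IH.
rewrite andbT; apply/hasPn => _ /mapP[s /avoiders_cons[x [t ->]] ->].
by apply/negP => /mapP[].
Qed.

Lemma size_one_line n (pi : 'S_n) : size (one_line pi) = n.
Proof. by rewrite size_map size_enum_ord. Qed.

Lemma nth_one_line n (pi : 'S_n) (i : 'I_n) : nth 0 (one_line pi) i = (pi i).+1.
Proof. by rewrite (nth_map i) ?size_enum_ord // nth_ord_enum. Qed.

Lemma one_line_uniq n (pi : 'S_n) : uniq (one_line pi).
Proof.
rewrite map_inj_uniq ?enum_uniq // => i j [/val_inj/perm_inj //].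
Qed.

Lemma one_line_inj n : injective (@one_line n).
Proof.
move=> p q E; apply/permP => i; apply: val_inj; apply: succn_inj.
by rewrite -!nth_one_line E.
Qed.

Lemma perm_one_line n (pi : 'S_n) : perm_eq (one_line pi) (iota 1 n).
Proof.
apply: uniq_perm; rewrite ?one_line_uniq ?iota_uniq //.
have [|//|_ //] := uniq_min_size (one_line_uniq _ pi) (s2 := iota 1 n).
  by move=> _ /mapP[i _ ->]; rewrite mem_iota /= add1n ltnS.
by rewrite size_one_line size_iota.
Qed.

Lemma one_line_surj n (s : seq nat) :
  perm_eq s (iota 1 n) -> exists pi : 'S_n, one_line pi = s.
Proof.
move=> ps.
have sz : size s = n by rewrite (perm_size ps) size_iota.
have us : uniq s by rewrite (perm_uniq ps) iota_uniq.
have rg i : i < n -> 0 < nth 0 s i <= n.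
  move=> lt; have : nth 0 s i \in s by rewrite mem_nth ?sz.
  by rewrite (perm_mem ps) mem_iota add1n ltnS.
(* The permutation sends [i] to its letter lowered by one; since all letters are positive, distinct
   ones stay distinct. *)
have lt (i : 'I_n) : (nth 0 s i).-1 < n by have := rg i (ltn_ord i); lia.
have f_inj : injective (fun i => Ordinal (lt i)).
  move=> i j [E]; apply/val_inj/eqP.
  rewrite /= -(nth_uniq 0 _ _ us) ?sz //.
  by move: (rg i (ltn_ord i)) (rg j (ltn_ord j)) E; case: nth => [|a] //; case: nth => [|b] // _ _ /= ->.
exists (perm f_inj); apply: (@eq_from_nth _ 0); rewrite size_one_line ?sz // => i lti.
rewrite (nth_one_line _ _ (Ordinal lti)) permE /=.
by have := rg i lti; lia.
Qed.

Lemma avoids_231_321P n (pi : 'S_n) :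
  all (avoids pi) [:: [:: 2; 3; 1]; [:: 3; 2; 1]] <->
  no_min_last_triple (one_line pi).
Proof.
rewrite /= andbT; split.
  case/andP=> /avoidsP H1 /avoidsP H2 a b c sub; apply: contraT; rewrite negb_or -!ltnNge.
  case/andP=> ca cb.
  have := subseq_uniq sub (one_line_uniq _ pi); rewrite /= !inE => ab.
  (* Letters are distinct, so the triple is an occurrence of 231 if [a < b] and of 321 if
     [b < a]. *)
  case: (ltngtP a b) => [lt|lt|E]; last by rewrite E eqxx in ab.
    case/negP: (H1 _ sub); rewrite /same_relative_order eqxx /=.
    by apply/forallP => -[[|[|[|]]] //= i]; apply/forallP => -[[|[|[|]]] //= j]; lia.
  case/negP: (H2 _ sub); rewrite /same_relative_order eqxx /=.
  by apply/forallP => -[[|[|[|]]] //= i]; apply/forallP => -[[|[|[|]]] //= j]; lia.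
move=> H.
suff av x y : 1 < x -> 1 < y -> avoids pi [:: x; y; 1] by rewrite !av.
move=> x1 y1; apply/avoidsP => -[|a [|b [|c [|]]]] // /H abc.
apply/negP => /andP[_ /= /'forall_forallP E].
have := E (@Ordinal 3 2 isT) (@Ordinal 3 0 isT).
have := E (@Ordinal 3 2 isT) (@Ordinal 3 1 isT).
by rewrite /=; lia.
Qed.

(** Without a descent at 1 the first ascent is 1, which is odd. With one it is 2, since a second
    descent would make the first three letters a 321. *)
Lemma desarrangementE n (pi : 'S_n.+2) :
  no_min_last_triple (one_line pi) ->
  desarrangement pi = (nth 0 (one_line pi) 1 < nth 0 (one_line pi) 0).
Proof.
move=> H; rewrite /desarrangement /first_ascent /=.
rewrite {1}/is_ascent {1}/is_descent /= /letter /=.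
case: ifP => [/negbTE -> //|/negbFE desc1]; rewrite desc1.
suff -> : is_ascent pi 2 by [].
rewrite /is_ascent /= /is_descent /letter /=; apply/negP => /andP[n2 desc2].
move: H desc1 desc2; have := size_one_line _ pi.
(* The last position is never a descent, so [n2] rules out a word of only two letters. *)
case: (one_line pi) => [|x [|y [|z s]]] //=; first by lia.
move=> _ /(_ x y z); rewrite /= !eqxx sub0seq => /(_ isT); lia.
Qed.

Theorem theorem3p15 (n : nat) (hn : 2 <= n) :
  num_desarr n [:: [:: 2; 3; 1]; [:: 3; 2; 1]] = 2 ^ (n - 2).
Proof.
case: n hn => [|[|n]] // _; rewrite subn2 /= -size_avoiders.
(* Both sides become sizes of duplicate-free lists of words of length [n.+2], which are then shown
   to have the same members. *)
rewrite -(size_map insert_second) /num_desarr cardE -(size_map (@one_line _)).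
apply/perm_size/uniq_perm.
- by rewrite (map_inj_uniq (one_line_inj _)) enum_uniq.
- by rewrite (map_inj_uniq insert_second_inj) uniq_avoiders.
move=> s; apply/mapP/mapP => [[pi]|[t Lt ->]].
  rewrite mem_enum inE => /andP[des /avoids_231_321P av] ->.
  rewrite desarrangementE // in des.
  have : one_line pi \in avoiders n.+1.
    by apply/avoidersP; split=> //; exact: perm_one_line.
  rewrite mem_cat => /orP[] /mapP[t Lt E]; last by exists t.
  (* A word that begins with 1 has no descent at its start. *)
  have [x [u Et]] := avoiders_cons _ _ Lt.
  by rewrite E Et in des.
have /avoidersP[ps H] : insert_second t \in avoiders n.+1.
  by rewrite mem_cat (map_f _ Lt) orbT.
have [pi E] := one_line_surj _ _ ps; exists pi => //.
rewrite -E in H; rewrite mem_enum inE desarrangementE //.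
apply/andP; split; last exact/avoids_231_321P.
by have [x [u Et]] := avoiders_cons _ _ Lt; rewrite E Et.
Qed.
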